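(* Let $f=\sum_{n=0}^\infty a_nz^n\in\mathbb X(\mathbb C)$. There exists $g\in\mathbb X(\mathbb C)$ such that $g\circ f=z$ if and only if $a_1\neq0$ and there exists $\tilde g\in\mathbb X(\mathbb C)$ such that $\tilde g\circ(z+a_0)=(f-a_0)^{[-1]}$. If such a $\tilde g$ exists (and $a_1\ne0$), then $g=\tilde g$, i.e. $\tilde g$ is a left composition inverse of $f$. Equivalently: there exists $g\in\mathbb X(\mathbb C)$ such that $g\circ f=z$ if and only if $a_1\ne0$ and the infinite linear system $P(a_0)[b_0\ b_1\ b_2\ \dots]^T=[c_0\ c_1\ c_2\ \dots]^T$, where $c_n$ is the coefficient of $z^n$ in $(f-a_0)^{[-1]}$, possesses a solution $(b_n)_{n\in\mathbb N_0}$ in $\mathbb C$. If such a solution exists, then $g=b_0+b_1z+b_2z^2+\cdots$, i.e. this series is a left composition inverse of $f$.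
   Context: $\mathbb N_0$ is the set of nonnegative integers; $\mathbb X(\mathbb C)$ is the set of all formal power series $f=\sum_{n=0}^\infty a_nz^n$ with $a_n\in\mathbb C$, with the Cauchy product. General composition: for $g=\sum_{k=0}^\infty b_kz^k\in\mathbb X(\mathbb C)$ let $\mathbb X_g$ be the set of all $f=\sum a_nz^n\in\mathbb X(\mathbb C)$ such that for every $n\in\mathbb N_0$ the series $\sum_{k=0}^\infty b_ka_n^{(k)}$ converges in $\mathbb C$, where $a_n^{(k)}$ is the coefficient of $z^n$ in $f^k$ ($f^0=1$). For $f\in\mathbb X_g$ put $g\circ f=\sum_{n=0}^\infty c_nz^n$ with $c_n=\sum_{k=0}^\infty b_ka_n^{(k)}$. An equation such as $g\circ f=z$ includes the assertion that the composition exists, i.e. $f\in\mathbb X_g$. If $h$ is a formal power series with zero constant term and nonzero coefficient of $z$, $h^{[-1]}$ denotes its (unique) composition inverse, a formal power series with zero constant term satisfying $h^{[-1]}\circ h=h\circ h^{[-1]}=z$. When $a_1\neq 0$ this applies to $h=f-a_0=a_1z+a_2z^2+\cdots$. For $A\in\mathbb C$, the generalized Pascal matrix $P(A)$ is the infinite upper triangular matrix, with rows and columns indexed by $\mathbb N_0$, whose $(k,n)$ entry is $\binom nkA^{n-k}$ for $n\ge k$ (with $A^0=1$) and $0$ for $n<k$. A sequence $(b_n)$ solves $P(A)[b_0\ b_1\ \dots]^T=[c_0\ c_1\ \dots]^T$ if for every $k\in\mathbb N_0$ the series $\sum_{n=k}^\infty\binom nkA^{n-k}b_n$ converges to $c_k$.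 *)

(* Defs.v *)
From HB Require Import structures.
From mathcomp Require Import all_boot all_order all_algebra.
From mathcomp Require Import complex.
From mathcomp Require Import all_classical all_reals all_analysis.

Set Implicit Arguments.
Unset Strict Implicit.
Unset Printing Implicit Defensive.

Import Order.TTheory GRing.Theory Num.Theory.
Import numFieldNormedType.Exports.

Local Open Scope classical_set_scope.
Local Open Scope ring_scope.

(* [R[i]] is packed as a [numFieldType] because MathComp-Analysis only attaches
   the norm topology to carriers of that form. *)
Definition C (R : realType) : numFieldType := complex R.

(* A formal power series is its sequence of coefficients; sums and differences
   are the pointwise [\+] and [\-], but the product is [fps_mul]. *)
Definition fps (R : realType) : Type := nat -> C R.

Definition fps_const (R : realType) (a : C R) : fps R :=
  fun n => if n == 0%N then a else 0.

Definition fps_X (R : realType) : fps R := fun n => (n == 1%N)%:R.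

Definition fps_mul (R : realType) (f g : fps R) : fps R :=
  fun n => \sum_(i < n.+1) f i * g (n - i)%N.

Definition fps_pow (R : realType) (f : fps R) (k : nat) : fps R :=
  iter k (fps_mul f) (fps_const 1).

(* [composable g f] is f \in X_g. *)
Definition composable (R : realType) (g f : fps R) : Prop :=
  forall n : nat, cvgn (series (fun k => g k * fps_pow f k n)).

(* Meaningful only when [composable g f]. *)
Definition fps_comp (R : realType) (g f : fps R) : fps R :=
  fun n => limn (series (fun k => g k * fps_pow f k n)).

(* The equation g o f = h, including the existence of the composition. *)
Definition comp_eq (R : realType) (g f h : fps R) : Prop :=
  composable g f /\ fps_comp g f = h.

Definition is_comp_inverse (R : realType) (h u : fps R) : Prop :=
  [/\ u 0%N = 0, comp_eq u h (@fps_X R) & comp_eq h u (@fps_X R)].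

(* h^[-1], by choice: a series satisfying [is_comp_inverse h] exists and is
   unique when [h 0 = 0] and [h 1 != 0]; the value is irrelevant otherwise. *)
Definition comp_inverse (R : realType) (h : fps R) : fps R :=
  xget (fps_const 0 : nat -> C R) [set u | is_comp_inverse h u].

Definition pascal (R : realType) (A : C R) (k n : nat) : C R :=
  if (k <= n)%N then 'C(n, k)%:R * A ^+ (n - k) else 0.

(* P(A) b = c, row by row. *)
Definition pascal_solution (R : realType) (A : C R) (b c : nat -> C R) : Prop :=
  forall k : nat,
    (fun N : nat => \sum_(k <= n < N) pascal A k n * b n) @ \oo --> c k.

(* Main.v *)
Require Import Defs.
From HB Require Import structures.
From mathcomp Require Import all_boot all_order all_algebra.
From mathcomp Require Import complex.
From mathcomp Require Import all_classical all_reals all_analysis.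

(** Write [f = h + a0] with [h] of zero constant term. The binomial formula
    expands [f^k] as the sum over [j] of [binom(k, j) a0^(k-j) h^j], and only
    [j <= n] matters for the coefficient of [z^n], because [h^j] starts at
    [z^j]. Hence the [N]-th partial sum of the series defining the [n]-th
    coefficient of [g o f] is a finite combination, over [j <= n], of the [N]-th
    partial sums of the rows of the system [P(a0) b], with weights the
    coefficients of [h^j] ([series_comp_shift]).

    These weights form a lower triangular matrix with diagonal entries [a1^n].
    If [a1 != 0], the matrix is invertible row by row, so convergence of all the
    combinations amounts to convergence of all the Pascal rows, and the limits
    correspond through the matrix ([triangular_cvg]). As the matrix maps the
    coefficients of [h^[-1]] to those of [z] (this is [h^[-1] o h = z]), the
    equation [g o f = z] says exactly that [g] solves the Pascal system with
    right-hand side [h^[-1]] ([comp_eq_pascal]). The case [h = z] of the same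
    computation identifies the Pascal system with the equation
    [g o (z + a0) = h^[-1]] ([comp_eq_shiftX]). Finally, if [a1 = 0], no power
    of [f] has a term in [z], so [g o f] cannot be [z] ([comp_eq_X_coef1]).

    The existence of [h^[-1]] also comes from the triangular matrix: solving
    the system gives [u] with [u o h = z], and then [(h o u) o h = h = z o h]
    forces [h o u = z] by injectivity ([fps_subst_right_inverse]). *)

Set Implicit Arguments.
Unset Strict Implicit.
Unset Printing Implicit Defensive.

Import Order.TTheory GRing.Theory Num.Theory.
Import numFieldNormedType.Exports.

Local Open Scope classical_set_scope.
Local Open Scope ring_scope.

(** * Finite sums and infinite lower triangular systems *)

Lemma sum_ord_widen0 (V : nmodType) (F : nat -> V) (m M : nat) :
  (m <= M)%N -> (forall i, (m <= i)%N -> F i = 0) ->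
  \sum_(i < M) F i = \sum_(i < m) F i.
Proof.
move=> lemM F0; rewrite (big_ord_widen _ F lemM) [RHS]big_mkcond /=.
by apply: eq_bigr => i _; case: ltnP => // /F0.
Qed.

(** Forward substitution. The unknowns already found are kept in a list, since
    each new one depends on all the previous ones. *)
Fixpoint triangular_prefix (K : fieldType) (L : nat -> nat -> K) (s : nat -> K)
    (n : nat) : seq K :=
  if n is m.+1 then
    let p := triangular_prefix L s m in
    rcons p ((s m - \sum_(j < m) L m j * p`_j) / L m m)
  else [::].

Lemma size_triangular_prefix (K : fieldType) (L : nat -> nat -> K)
    (s : nat -> K) (n : nat) :
  size (triangular_prefix L s n) = n.
Proof. by elim: n => //= n IH; rewrite size_rcons IH. Qed.

Lemma nth_triangular_prefix (K : fieldType) (L : nat -> nat -> K)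
    (s : nat -> K) (n j : nat) :
  (j < n)%N -> (triangular_prefix L s n)`_j = (triangular_prefix L s j.+1)`_j.
Proof.
elim: n => // n IH; rewrite ltnS leq_eqVlt => /predU1P[-> //|ltjn].
by rewrite [LHS]/= nth_rcons size_triangular_prefix ltjn IH.
Qed.

Lemma triangular_solve (K : fieldType) (L : nat -> nat -> K) (s : nat -> K) :
  (forall n, L n n != 0) ->
  exists t : nat -> K, forall n, \sum_(j < n.+1) L n j * t j = s n.
Proof.
move=> Lnn; exists (fun n => (triangular_prefix L s n.+1)`_n) => n.
rewrite big_ord_recr /= nth_rcons size_triangular_prefix ltnn eqxx.
rewrite (eq_bigr (fun j : 'I_n => L n j * (triangular_prefix L s n)`_j));
  last first.
  by move=> j _; rewrite nth_triangular_prefix.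
by rewrite [L n n * _]mulrC divfK // addrC subrK.
Qed.

Lemma triangular_inj (K : fieldType) (L : nat -> nat -> K) (t t' : nat -> K) :
  (forall n, L n n != 0) ->
  (forall n, \sum_(j < n.+1) L n j * t j = \sum_(j < n.+1) L n j * t' j) ->
  t =1 t'.
Proof.
move=> Lnn E n; elim/ltn_ind: n => n IH; have := E n.
rewrite !big_ord_recr /= (eq_bigr (fun j : 'I_n => L n j * t' j)).
  by move/addrI/(mulfI (Lnn n)).
by move=> j _; rewrite IH.
Qed.

Lemma cvg_lin_comb (K : numFieldType) (n : nat) (a : nat -> K)
    (T : nat -> nat -> K) (t : nat -> K) :
  (forall j, (j < n)%N -> T ^~ j @ \oo --> t j) ->
  (fun N => \sum_(j < n) a j * T N j) @ \oo --> \sum_(j < n) a j * t j.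
Proof.
elim: n => [|n IH] cvT.
  by under eq_cvg do rewrite big_ord0; rewrite big_ord0; exact: cvg_cst.
under eq_cvg do rewrite big_ord_recr; rewrite big_ord_recr /=.
apply: cvgD; last by apply: cvgMl_tmp; exact: cvT.
by apply: IH => j ltjn; apply: cvT; exact: ltnW.
Qed.

(** A lower triangular matrix with nonzero diagonal and its inverse both have
    finitely supported rows, so each is continuous for entrywise convergence. *)
Lemma triangular_cvg (K : numFieldType) (L : nat -> nat -> K)
    (T : nat -> nat -> K) (t : nat -> K) :
  (forall n, L n n != 0) ->
  (forall n, (fun N => \sum_(j < n.+1) L n j * T N j) @ \oo
               --> \sum_(j < n.+1) L n j * t j) <->
  (forall j, T ^~ j @ \oo --> t j).
Proof.
move=> Lnn; split=> [cvS n|cvT n]; last first.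
  by refine (cvg_lin_comb _) => j _; exact: cvT.
elim/ltn_ind: n => n IH.
have -> : T ^~ n = (fun N => (L n n)^-1 *
    (\sum_(j < n.+1) L n j * T N j - \sum_(j < n) L n j * T N j)).
  by apply/funext => N; rewrite big_ord_recr /= addrAC subrr add0r mulKf.
have -> : t n = (L n n)^-1 *
    (\sum_(j < n.+1) L n j * t j - \sum_(j < n) L n j * t j).
  by rewrite big_ord_recr /= addrAC subrr add0r mulKf.
apply: cvgMl_tmp; apply: cvgB; first exact: cvS.
by refine (cvg_lin_comb _) => j ltjn; exact: IH.
Qed.

(** * Coefficients of powers *)

(** Reducing to powers of a truncation makes the polynomial library, and in
    particular its binomial formula, available for power series. *)
Lemma fps_powE (R : realType) (f : fps R) (N k n : nat) :
  (n < N)%N -> fps_pow f k n = ((\poly_(i < N) f i) ^+ k)`_n.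
Proof.
elim: k n => [|k IH] n ltnN.
  by rewrite expr0 coef1 /fps_pow /= /fps_const; case: (n == 0%N).
rewrite exprS coefM /fps_pow iterS; apply: eq_bigr => i _.
rewrite coef_poly (leq_trans (ltn_ord i) ltnN); congr (_ * _).
by apply: IH; apply: leq_ltn_trans ltnN; exact: leq_subr.
Qed.

Lemma fps_pow_lt (R : realType) (h : fps R) (j n : nat) :
  h 0%N = 0 -> (n < j)%N -> fps_pow h j n = 0.
Proof.
move=> h0; elim: j n => // j IH n ltnj.
rewrite /fps_pow iterS /fps_mul big_ord_recl h0 mul0r add0r.
apply: big1 => i _; rewrite [iter _ _ _ _]IH ?mulr0 //=.
rewrite /bump /= add1n; case: n ltnj i => [|n] ltnj [i lti] //=.
by rewrite subSS; apply: leq_ltn_trans (leq_subr _ _) _.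
Qed.

Lemma fps_pow_diag (R : realType) (h : fps R) (j : nat) :
  h 0%N = 0 -> fps_pow h j j = h 1%N ^+ j.
Proof.
move=> h0; elim: j => // j IH; rewrite exprS -IH.
rewrite [LHS]/fps_pow iterS /fps_mul !big_ord_recl h0 mul0r add0r /=.
rewrite subSS subn0.
rewrite big1 ?addr0 // => i _; rewrite [iter _ _ _ _]fps_pow_lt ?mulr0 //=.
rewrite /bump /= !add1n; case: j {IH} i => [[]//|j] i.
by rewrite !subSS; apply: leq_ltn_trans (leq_subr _ _) _.
Qed.

Lemma poly_fps_X (R : realType) (n : nat) :
  \poly_(i < n.+2) (@fps_X R) i = 'X.
Proof.
apply/polyP => i; rewrite coef_poly coefX /fps_X.
by case: ltnP => //; case: i => [|[]].
Qed.

Lemma fps_pow_X (R : realType) (j n : nat) :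
  fps_pow (@fps_X R) j n = (n == j)%:R.
Proof.
have ltn2 : (n < n.+2)%N by exact: leqnSn.
by rewrite (fps_powE _ _ ltn2) poly_fps_X coefXn.
Qed.

(** The binomial formula for [(h + a)^k], cut at [j <= n] because the powers
    [h^j] with [j > n] have no term in [z^n]. *)
Lemma fps_pow_shift (R : realType) (h : fps R) (a : C R) (k n : nat) :
  h 0%N = 0 ->
  fps_pow (h \+ fps_const a) k n =
    \sum_(j < n.+1) fps_pow h j n * pascal a j k.
Proof.
move=> h0; rewrite (fps_powE _ _ (ltnSn n)).
have -> : \poly_(i < n.+1) (h \+ fps_const a) i = a%:P + \poly_(i < n.+1) h i.
  apply/polyP => i; rewrite coefD coefC !coef_poly /= /fps_const.
  case: ltnP => [_|/(leq_ltn_trans (leq0n n)) igt0]; first by rewrite addrC.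
  by rewrite gtn_eqF // addr0.
rewrite exprDn coef_sum.
rewrite (eq_bigr (fun j : 'I_k.+1 => fps_pow h j n * pascal a j k)); last first.
  move=> j _; rewrite coefMn -rmorphXn coefCM -(fps_powE _ _ (ltnSn n)).
  rewrite /pascal (leq_ord j) [_ * fps_pow _ _ _]mulrC.
  by rewrite -mulrnAr -[a ^+ _ *+ _]mulr_natl.
pose F j := fps_pow h j n * pascal a j k.
(* The summand vanishes for [j > k] through the Pascal factor and for [j > n]
   through the power of [h], so both ranges extend to a common one. *)
transitivity (\sum_(j < k.+1 + n.+1) F j); [symmetry|];
  apply: (sum_ord_widen0 (F := F)).
- exact: leq_addr.
- by move=> i ltki; rewrite /F /pascal leqNgt ltki mulr0.
- exact: leq_addl.
- by move=> i ltni; rewrite /F fps_pow_lt ?mul0r.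
Qed.

(** * Composition with a series without constant term *)

Lemma coef_exp_low0 (K : fieldType) (q : {poly K}) (k n : nat) :
  q`_0 = 0 -> (n < k)%N -> (q ^+ k)`_n = 0.
Proof.
move=> q0; have /factor_theorem[r ->] : root q 0.
  by rewrite /root horner_coef0 q0.
by rewrite subr0 exprMn => ltnk; rewrite coefMXn ltnk.
Qed.

Lemma coef_comp_low (K : fieldType) (p q : {poly K}) (n : nat) :
  q`_0 = 0 -> (p \Po q)`_n = \sum_(i < n.+1) p`_i * (q ^+ i)`_n.
Proof.
move=> q0; rewrite coef_comp_poly; pose F i := p`_i * (q ^+ i)`_n.
transitivity (\sum_(i < size p + n.+1) F i); [symmetry|];
  apply: (sum_ord_widen0 (F := F)).
- exact: leq_addr.
- by move=> i lei; rewrite /F nth_default ?mul0r.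
- exact: leq_addl.
- by move=> i ltni; rewrite /F coef_exp_low0 ?mulr0.
Qed.

(** Coefficients of a composition up to [n] depend only on those of the inner
    polynomial up to [n], since this holds for each power. *)
Lemma eq_coef_comp (K : fieldType) (p q q' : {poly K}) (n : nat) :
  (forall i, (i <= n)%N -> q`_i = q'`_i) -> (p \Po q)`_n = (p \Po q')`_n.
Proof.
move=> eqq; rewrite !coef_comp_poly; apply: eq_bigr => k _; congr (_ * _).
elim: {k}(k : nat) {-2}n (leqnn n) => [//|k IH] m lemn.
rewrite !exprS !coefM; apply: eq_bigr => i _.
rewrite eqq ?IH //; first exact: leq_trans (leq_subr _ _) lemn.
by apply: leq_trans lemn; rewrite -ltnS.
Qed.

(** The composition [c o h] when [h] has zero constant term: a finite sum, and
    the image of the sequence [c] under the lower triangular matrix of the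
    coefficients of the powers of [h]. *)
Definition fps_subst (R : realType) (c h : fps R) : fps R :=
  fun n => \sum_(j < n.+1) fps_pow h j n * c j.

Lemma fps_substE (R : realType) (c h : fps R) (N n : nat) :
  h 0%N = 0 -> (n < N)%N ->
  fps_subst c h n = ((\poly_(i < N) c i) \Po (\poly_(i < N) h i))`_n.
Proof.
move=> h0 ltnN; rewrite coef_comp_low; last by rewrite coef_poly h0 if_same.
apply: eq_bigr => i _; rewrite -fps_powE // coef_poly mulrC.
by rewrite (leq_trans (ltn_ord i)).
Qed.

Lemma fps_subst_inj (R : realType) (h c c' : fps R) :
  h 0%N = 0 -> h 1%N != 0 -> fps_subst c h =1 fps_subst c' h -> c =1 c'.
Proof.
move=> h0 h1; apply: (triangular_inj (L := fun n j => fps_pow h j n)) => n.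
by rewrite fps_pow_diag ?expf_neq0.
Qed.

(** By injectivity of [c |-> c o h] it suffices that [(h o u) o h = z o h], and
    associativity turns the left-hand side into [h o (u o h) = h o z = h].
    Associativity is borrowed from polynomial composition, on truncations. *)
Lemma fps_subst_right_inverse (R : realType) (h u : fps R) :
  h 0%N = 0 -> h 1%N != 0 -> u 0%N = 0 ->
  fps_subst u h =1 @fps_X R -> fps_subst h u =1 @fps_X R.
Proof.
move=> h0 h1 u0 uh; apply: (fps_subst_inj h0 h1) => n.
have H0 : (\poly_(i < n.+1) h i)`_0 = 0 by rewrite coef_poly h0.
rewrite (fps_substE _ h0 (ltnSn n)).
transitivity ((((\poly_(i < n.+1) h i) \Po (\poly_(i < n.+1) u i)) \Po
   (\poly_(i < n.+1) h i))`_n).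
  rewrite !coef_comp_low //; apply: eq_bigr => i _; congr (_ * _).
  by rewrite coef_poly ltn_ord (fps_substE _ u0 (ltn_ord i)).
rewrite -comp_polyA (eq_coef_comp _ (q' := 'X)); last first.
  by move=> i lein; rewrite -fps_substE // uh coefX.
rewrite comp_polyXr coef_poly ltnSn.
have ltn2 : (n < n.+2)%N by exact: leqnSn.
by rewrite (fps_substE _ h0 ltn2) poly_fps_X comp_polyX coef_poly ltn2.
Qed.

Lemma comp_eqP (R : realType) (g f h : fps R) :
  comp_eq g f h <->
  (forall n, series (fun k => g k * fps_pow f k n) @ \oo --> h n).
Proof.
split=> [[cv <-] n|cv]; first exact: cv.
split=> [n|]; first by apply/cvg_ex; exists (h n); exact: cv.
by apply/funext => n; apply: cvg_lim => //; exact: cv.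
Qed.

(** When [h] has zero constant term the series defining [c o h] are eventually
    constant. *)
Lemma comp_eq_subst (R : realType) (c h s : fps R) :
  h 0%N = 0 -> comp_eq c h s <-> fps_subst c h =1 s.
Proof.
move=> h0; rewrite comp_eqP.
have cv n : series (fun k => c k * fps_pow h k n) @ \oo --> fps_subst c h n.
  apply: cvg_near_cst; near=> N.
  rewrite /series /= big_mkord.
  pose F k := c k * fps_pow h k n.
  rewrite (sum_ord_widen0 (m := n.+1) (F := F)); first last.
  - by move=> i ltni; rewrite /F fps_pow_lt ?mulr0.
  - by near: N; exact: nbhs_infty_ge.
  by apply: eq_bigr => i _; rewrite mulrC.
split=> [cs n|E n]; last by rewrite -E.
exact: norm_cvg_unique (cv n) (cs n).
Unshelve. all: by end_near.
Qed.

Lemma comp_inverseP (R : realType) (h : fps R) :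
  h 0%N = 0 -> h 1%N != 0 -> is_comp_inverse h (comp_inverse h).
Proof.
move=> h0 h1; rewrite /comp_inverse; case: xgetP => [u _ //|none].
have [|u uh] := @triangular_solve _ (fun n j => fps_pow h j n) (@fps_X R).
  by move=> n; rewrite fps_pow_diag ?expf_neq0.
have u0 : u 0%N = 0.
  by have := uh 0%N; rewrite big_ord1 /= /fps_pow /= /fps_const /= mul1r.
case: (none u); split => //; apply/comp_eq_subst => //.
exact: fps_subst_right_inverse.
Qed.

(** * Composition with a nonzero constant term *)

(** The key identity: at the level of partial sums the composition with [h + a]
    factors as the Pascal system followed by the composition with [h]. The inner
    sum is exact also for [N <= j], where it is empty. *)
Lemma series_comp_shift (R : realType) (g h : fps R) (a : C R) (n N : nat) :
  h 0%N = 0 ->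
  series (fun k => g k * fps_pow (h \+ fps_const a) k n) N =
  \sum_(j < n.+1) fps_pow h j n * \sum_(j <= k < N) pascal a j k * g k.
Proof.
move=> h0; rewrite /series /=.
under eq_bigr do rewrite fps_pow_shift // mulr_sumr.
rewrite exchange_big /=; apply: eq_bigr => j _.
rewrite mulr_sumr; have [leNj|ltjN] := leqP N j.
  rewrite [RHS]big_geq // big_nat big1 // => k ltkN.
  by rewrite /pascal leqNgt (leq_trans _ leNj) ?mulr0.
rewrite (big_cat_nat (leq0n j) (ltnW ltjN)) /= big_nat big1 ?add0r.
  by apply: eq_bigr => k _; rewrite mulrCA [g k * _]mulrC.
by move=> k /andP[_ ltkj]; rewrite /pascal leqNgt ltkj !mulr0.
Qed.

Lemma comp_eq_shiftX (R : realType) (a : C R) (b c : fps R) :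
  comp_eq b (@fps_X R \+ fps_const a) c <-> pascal_solution a b c.
Proof.
have X0 : @fps_X R 0%N = 0 by [].
rewrite comp_eqP; suff E n : series (fun k => b k *
    fps_pow (@fps_X R \+ fps_const a) k n) =
    (fun N => \sum_(n <= k < N) pascal a n k * b k).
  by split=> cv n; have := cv n; rewrite E.
apply/funext => N; rewrite series_comp_shift // (bigD1 ord_max) //=.
rewrite fps_pow_X eqxx mul1r [X in _ + X]big1 ?addr0 // => j neqj.
rewrite -(inj_eq val_inj) eq_sym /= in neqj.
by rewrite fps_pow_X (negbTE neqj) mul0r.
Qed.

(** Since [h^[-1] o h = z], the Pascal rows converge to the coefficients of
    [h^[-1]] if and only if their images under the triangular matrix of [h]
    converge to the coefficients of [z]. *)
Lemma comp_eq_pascal (R : realType) (h : fps R) (a : C R) (g : fps R) :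
  h 0%N = 0 -> h 1%N != 0 ->
  comp_eq g (h \+ fps_const a) (@fps_X R) <->
  pascal_solution a g (comp_inverse h).
Proof.
move=> h0 h1; have [_ /(comp_eq_subst _ _ h0) uh _] := comp_inverseP h0 h1.
have diag n : fps_pow h n n != 0 by rewrite fps_pow_diag ?expf_neq0.
have [rows_cvg comb_cvg] := @triangular_cvg _ (fun n j => fps_pow h j n)
  (fun N j => \sum_(j <= k < N) pascal a j k * g k) (comp_inverse h) diag.
have E n : series (fun k => g k * fps_pow (h \+ fps_const a) k n) =
    (fun N => \sum_(j < n.+1)
       fps_pow h j n * \sum_(j <= k < N) pascal a j k * g k).
  by apply/funext => N; exact: series_comp_shift.
rewrite comp_eqP; split=> [cv|/comb_cvg cv n]; last by rewrite E -uh; exact: cv.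
by apply: rows_cvg => n; have := cv n; rewrite E -uh.
Qed.

(** If the coefficient of [z] in [h] vanishes, so does the one in every power of
    [h + a], and the composition has no term in [z]. *)
Lemma comp_eq_X_coef1 (R : realType) (h : fps R) (a : C R) (g : fps R) :
  h 0%N = 0 -> comp_eq g (h \+ fps_const a) (@fps_X R) -> h 1%N != 0.
Proof.
move=> h0 /comp_eqP /(_ 1%N) cv; apply: contraPneq cv => h1.
have -> : series (fun k => g k * fps_pow (h \+ fps_const a) k 1) = fun=> 0.
  apply/funext => N; rewrite series_comp_shift //; apply: big1 => j _.
  have -> : fps_pow h j 1%N = 0; last exact: mul0r.
  case: j => [[|[|//]] ltj2]; first by [].
  by rewrite [LHS]fps_pow_diag // h1 expr1.
move=> cv; have X10 : @fps_X R 1%N = 0 by exact: norm_cvg_unique cv (cvg_cst _).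
by have := oner_neq0 (C R); rewrite -[1]/(@fps_X R 1%N) X10 eqxx.
Qed.

Theorem theorem3p6 (R : realType) (f : fps R) :
  let a0 : C R := f 0%N in
  let a1 : C R := f 1%N in
  let hinv : fps R := comp_inverse (f \- fps_const a0) in
  [/\ (exists g : fps R, comp_eq g f (@fps_X R)) <->
        (a1 != 0 /\
         exists gt : fps R, comp_eq gt (@fps_X R \+ fps_const a0) hinv),
      forall gt : fps R,
        a1 != 0 -> comp_eq gt (@fps_X R \+ fps_const a0) hinv ->
        comp_eq gt f (@fps_X R),
      (exists g : fps R, comp_eq g f (@fps_X R)) <->
        (a1 != 0 /\ exists b : nat -> C R, pascal_solution a0 b hinv) &
      forall b : nat -> C R,
        a1 != 0 -> pascal_solution a0 b hinv ->
        comp_eq b f (@fps_X R)].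
Proof.
move=> a0 a1 hinv; set h := f \- fps_const a0 in hinv *.
have h0 : h 0%N = 0 by exact: subrr.
have h1 : h 1%N = a1 by exact: subr0.
have fE : f = h \+ fps_const a0 by apply/funext => n; rewrite /= subrK.
have coef1 g : comp_eq g f (@fps_X R) -> a1 != 0.
  by rewrite fE -h1; exact: comp_eq_X_coef1.
have leftP g : a1 != 0 ->
    comp_eq g f (@fps_X R) <-> pascal_solution a0 g hinv.
  by rewrite -h1 => nz1; rewrite [in X in X <-> _]fE; exact: comp_eq_pascal.
split.
- split=> [[g gf]|[nz1 [g /comp_eq_shiftX/(leftP _ nz1)]]]; last by exists g.
  split; first exact: coef1 gf.
  by exists g; apply/comp_eq_shiftX/leftP => //; exact: coef1 gf.
- by move=> g nz1 /comp_eq_shiftX/(leftP _ nz1).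
- split=> [[g gf]|[nz1 [g /(leftP _ nz1)]]]; last by exists g.
  by split; [exact: coef1 gf | exists g; apply/leftP => //; exact: coef1 gf].
- by move=> g nz1 /(leftP _ nz1).
Qed.
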